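(* The variety $\mathcal W_2$ is defined by the commutative ai-semiring axioms together with $xy+x\approx xy$ and $x^2+z\approx x^2$. The variety $\mathcal W_2$ is finitely based but not hereditarily finitely based. For every $k\geq3$, the variety $\mathcal W_k$ is nonfinitely based.
   Context: An additively idempotent semiring (ai-semiring) is an algebra $(S,+,\cdot)$ of signature $(2,2)$, without constants, such that $(S,+)$ is a commutative idempotent semigroup, $(S,\cdot)$ is a semigroup, and multiplication distributes over addition. It is commutative if its multiplication is commutative. All varieties are in the signature $(2,2)$. A variety is finitely based if it can be defined by finitely many identities, and hereditarily finitely based if each of its subvarieties is finitely based. $\mathbf N$ is the ai-semiring on the nonnegative integers $\mathbb N_0$ whose semiring addition is $\max$ and whose semiring multiplication is numerical addition; $\mathcal M=\mathsf V(\mathbf N)$ is the variety it generates. For $k\geq2$, $\mathcal W_k$ is the subvariety of $\mathcal M$ defined within $\mathcal M$ by the identity $x^k+z\approx x^k$. *)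

(* Defs.v *)
From Stdlib Require List.
From mathcomp Require Import all_boot.
Set Implicit Arguments.
Unset Strict Implicit.
Unset Printing Implicit Defensive.

(* Algebras of signature (2,2).  The witness only makes the carrier nonempty:
   it is not an operation, and homomorphisms and identities ignore it. *)
Record algebra := Algebra {
  carrier :> Type;
  witness : carrier;
  add : carrier -> carrier -> carrier;
  mul : carrier -> carrier -> carrier
}.

Arguments add {a} _ _ : rename.
Arguments mul {a} _ _ : rename.

Inductive term : Type :=
| Var of nat
| Add of term & term
| Mul of term & term.

Declare Scope term_scope.
Delimit Scope term_scope with T.
Bind Scope term_scope with term.
Notation "s + t" := (Add s t) : term_scope.
Notation "s * t" := (Mul s t) : term_scope.

Fixpoint eval (A : algebra) (v : nat -> A) (t : term) : A :=
  match t with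
  | Var n => v n
  | Add s t => add (eval v s) (eval v t)
  | Mul s t => mul (eval v s) (eval v t)
  end.

Record identity := Identity { lhs : term; rhs : term }.

Notation "s ≈ t" := (Identity s%T t%T) (at level 70, no associativity).

Definition satisfies (A : algebra) (e : identity) : Prop :=
  forall v : nat -> A, eval v (lhs e) = eval v (rhs e).

Definition homomorphism (A B : algebra) (f : A -> B) : Prop :=
  {morph f : x y / add x y} /\ {morph f : x y / mul x y}.

Definition product_algebra (I : Type) (F : I -> algebra) : algebra :=
  {| carrier := forall i, F i;
     witness := fun i => witness (F i);
     add := fun x y i => add (x i) (y i);
     mul := fun x y i => mul (x i) (y i) |}.

Definition algebra_class := algebra -> Prop.

(* Closure under H, S and P; S is taken up to isomorphism. *)
Record is_variety (V : algebra_class) : Prop := IsVariety {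
  variety_H : forall (A B : algebra) (f : A -> B),
    homomorphism f -> (forall b, exists a, f a = b) -> V A -> V B;
  variety_S : forall (A B : algebra) (f : B -> A),
    homomorphism f -> injective f -> V A -> V B;
  variety_P : forall (I : Type) (F : I -> algebra),
    (forall i, V (F i)) -> V (product_algebra F)
}.

Definition generated_variety (A : algebra) : algebra_class :=
  fun B => forall V : algebra_class, is_variety V -> V A -> V B.

Definition subvariety (U V : algebra_class) : Prop :=
  is_variety U /\ forall A, U A -> V A.

Definition defined_by (V : algebra_class) (Sigma : seq identity) : Prop :=
  forall A, V A <-> forall e, List.In e Sigma -> satisfies A e.

Definition finitely_based (V : algebra_class) : Prop :=
  exists Sigma : seq identity, defined_by V Sigma.

Definition hereditarily_finitely_based (V : algebra_class) : Prop :=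
  forall U, subvariety U V -> finitely_based U.

Definition x := Var 0.
Definition y := Var 1.
Definition z := Var 2.

Definition comm_ai_semiring_axioms : seq identity :=
  [:: (x + y) + z ≈ x + (y + z);
      x + y ≈ y + x;
      x + x ≈ x;
      (x * y) * z ≈ x * (y * z);
      x * (y + z) ≈ x * y + x * z;
      (x + y) * z ≈ x * z + y * z;
      x * y ≈ y * x ].

(* The product of k copies of t; only meaningful for k >= 1, since the
   signature has no constant 1 (the value at k = 0 is the junk value t). *)
Definition term_pow (t : term) (k : nat) : term := iterop k Mul t t.

Notation "t ^ k" := (term_pow t k) : term_scope.

Definition algN : algebra :=
  {| carrier := nat; witness := 0; add := maxn; mul := addn |}.

Definition varM : algebra_class := generated_variety algN.

Definition W (k : nat) : algebra_class :=
  fun A => varM A /\ satisfies A (x ^ k + z ≈ x ^ k).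

(* Main.v *)
From Stdlib Require List.
From Stdlib Require Import Classical_Prop ClassicalEpsilon.
From Stdlib Require Import FunctionalExtensionality PropExtensionality.
From mathcomp Require Import all_boot zify.
Require Import Defs.
Set Implicit Arguments.
Unset Strict Implicit.
Unset Printing Implicit Defensive.

(** Distributing products over sums turns a term into a finite set of words over
    the variables, and its value in the max-plus algebra [algN] is the largest
    weight of one of its words.  So [s ≈ t] holds in [algN] iff for each
    valuation each word of either term is dominated in weight by some word of
    the other.  By Birkhoff's theorem ([birkhoff]), an algebra lies in [varM] iff
    it satisfies all these identities.

    The basis of [W 2] ([W2_defined_by]).  Where squares are top, a term one of
    whose words has a repeated letter is top.  If all words of [s] are square
    free, the indicator valuation of the letters of a word [u] of [t] shows that
    [u] is a subword, up to order, of a word of [s].  In both cases the given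
    axioms yield [t <= s] ([W2_valid_le]).

    The negative results use the syntactic algebra of a set [P] of words: terms
    modulo the congruence that identifies two terms when the same contexts send
    all their words into [P] ([syntactic_algebra]).

    For [W 2], let [P] consist of the cliques of an odd cycle.  In its syntactic
    algebra the sum of the edges of that cycle is not top, but that of any
    shorter odd cycle is, because a shorter odd cycle has no homomorphism to the
    given one ([odd_cycle_fits_no_clique]).  So the identities saying that odd
    cycles are top define a subvariety of [W 2] in which none of them follows
    from the earlier ones; a reduced product shows that it has no finite basis
    ([not_hereditarily_finitely_based]).

    For [W k] with [k >= 3], an identity of [W k] is an identity of [algN] unless
    both of its sides contain a [k]-th power ([W_valid]).  Let [b] be the product
    of [n] variables [x_i], arranged in a cycle, and let [a_i] be [b] with [x_(i+1)]
    replaced by [x_i].  Since [b] is the barycenter of the [a_i], the identity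
    saying that [b] is at most the sum of the [a_i] holds in [algN].  It fails in
    the syntactic algebra of the set [P] of divisors of the [a_i].  But that
    algebra satisfies each identity of [W k] that is small compared to [n].  If
    an instance of one side has all of its words in [P], a word of the
    corresponding instance of the other side is dominated by boundedly many of
    these, hence by fewer than [n] of the [a_i].  The words that [n - 1] of the
    [a_i] dominate are in [P] ([facet_under_vertex]): the convex hull of all the
    [a_i] is needed to reach [b].  Thus no finite set of identities of [W k]
    defines it. *)

(** * Varieties, quotients and Birkhoff's theorem *)

Definition valid (A : algebra) (s t : term) : Prop :=
  forall v : nat -> A, eval v s = eval v t.

Definition term_algebra : algebra := Algebra (Var 0) Add Mul.

Definition subst (sigma : nat -> term) (t : term) : term :=
  eval (A := term_algebra) sigma t.

Lemma eval_subst (A : algebra) (v : nat -> A) sigma t :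
  eval v (subst sigma t) = eval (fun i => eval v (sigma i)) t.
Proof. by elim: t => //= s -> t ->. Qed.

Lemma subst_Var t : subst Var t = t.
Proof. by elim: t => //= s IHs t IHt;
  rewrite /subst /= -!/(subst _ _) IHs IHt. Qed.

Lemma eval_morph (A B : algebra) (f : A -> B) (v : nat -> A) t :
  homomorphism f -> f (eval v t) = eval (fun i => f (v i)) t.
Proof.
by move=> [fD fM]; elim: t => //= s IHs t IHt; rewrite ?fD ?fM IHs IHt.
Qed.

Lemma eq_eval (A : algebra) (v w : nat -> A) t :
  v =1 w -> eval v t = eval w t.
Proof. by move=> vw; elim: t => //= s -> t ->. Qed.

Lemma eval_product (I : Type) (F : I -> algebra)
    (v : nat -> product_algebra F) t i :
  eval v t i = eval (fun n => v n i) t.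
Proof. by elim: t => //= s -> t ->. Qed.

(** Functions out of [nat] lift along surjections; this lets a valuation in a
    quotient be represented upstairs. *)
Lemma lift_valuation (S T : Type) (q : S -> T) (v : nat -> T) :
  (forall t, exists s, q s = t) -> exists w : nat -> S, forall n, q (w n) = v n.
Proof.
move=> q_surj; pose c n := constructive_indefinite_description _ (q_surj (v n)).
by exists (fun n => proj1_sig (c n)) => n; exact: proj2_sig (c n).
Qed.

Lemma satisfies_variety (e : identity) : is_variety (fun A => satisfies A e).
Proof.
split=> [A B f fhom fsurj Ae v | A B f fhom finj Ae v | I F Fe v].
- have [w fw] := lift_valuation v fsurj.
  by rewrite -!(eq_eval _ fw) -!eval_morph // Ae.
- by apply: finj; rewrite !eval_morph // Ae.
- by apply: functional_extensionality_dep => i; rewrite !eval_product Fe.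
Qed.

Lemma variety_inter (T : Type) (V : T -> algebra_class) :
  (forall i, is_variety (V i)) -> is_variety (fun A => forall i, V i A).
Proof.
move=> Vvar; split=> [A B f fhom fsurj VA i | A B f fhom finj VA i | I F VF i].
- exact: (variety_H (Vvar i) fhom fsurj (VA i)).
- exact: (variety_S (Vvar i) fhom finj (VA i)).
- by apply: (variety_P (Vvar i)) => j; exact: VF.
Qed.

Lemma variety_and (V W : algebra_class) :
  is_variety V -> is_variety W -> is_variety (fun A => V A /\ W A).
Proof.
move=> Vv Wv; split=> [A B f fhom fs [VA WA] | A B f fhom fi [VA WA] | I F VF].
- by split; [exact: (variety_H Vv fhom fs VA) | exact: (variety_H Wv fhom fs WA)].
- by split; [exact: (variety_S Vv fhom fi VA) | exact: (variety_S Wv fhom fi WA)].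
- by split; [apply: (variety_P Vv) | apply: (variety_P Wv)] => i; case: (VF i).
Qed.

Lemma generated_variety_is_variety (A : algebra) :
  is_variety (generated_variety A).
Proof.
split=> [B C f fhom fs VB V Vv VA | B C f fhom fi VB V Vv VA | I F VF V Vv VA].
- exact: (variety_H Vv fhom fs (VB V Vv VA)).
- exact: (variety_S Vv fhom fi (VB V Vv VA)).
- by apply: (variety_P Vv) => i; exact: VF.
Qed.

Lemma generated_variety_valid (A B : algebra) s t :
  generated_variety A B -> valid A s t -> valid B s t.
Proof. by move=> AB Ast;
  exact: (AB _ (satisfies_variety (Identity s t)) Ast). Qed.

Record congruence (A : algebra) (R : A -> A -> Prop) : Prop := Congruence {
  cong_refl : forall a, R a a;
  cong_sym : forall a b, R a b -> R b a;
  cong_trans : forall a b c, R a b -> R b c -> R a c;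
  cong_add : forall a a' b b', R a a' -> R b b' -> R (add a b) (add a' b');
  cong_mul : forall a a' b b', R a a' -> R b b' -> R (mul a b) (mul a' b')
}.

Record quotient_map (A : algebra) (R : A -> A -> Prop) (B : algebra)
    (q : A -> B) : Prop := QuotientMap {
  quot_hom : homomorphism q;
  quot_surj : forall b, exists a, q a = b;
  quot_eq : forall a b, q a = q b <-> R a b
}.

Lemma quotient_exists (A : algebra) (R : A -> A -> Prop) :
  congruence R -> exists (B : algebra) (q : A -> B), quotient_map R q.
Proof.
case=> Rxx Rsym Rtr RD RM.
pose Q := {C : A -> Prop | exists a, C = R a}.
pose cls a : Q := exist _ (R a) (ex_intro _ a erefl).
pose cR (c : Q) := constructive_indefinite_description _ (proj2_sig c).
pose rep c := proj1_sig (cR c).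
have clsE a b : cls a = cls b <-> R a b.
  split=> [[/(f_equal (fun f => f b)) Rab] | Rab]; first by rewrite Rab.
  have RE : R a = R b.
    apply: functional_extensionality => c; apply: propositional_extensionality.
    by split; apply: Rtr => //; apply: Rsym.
  by apply: eq_sig_hprop => // C p p'; exact: proof_irrelevance.
have repE c : cls (rep c) = c.
  apply: eq_sig_hprop => [C p p'|]; first exact: proof_irrelevance.
  by rewrite /rep; case: (cR c).
have Rrep a : R (rep (cls a)) a by apply/clsE.
exists (Algebra (cls (witness A)) (fun c d => cls (add (rep c) (rep d)))
               (fun c d => cls (mul (rep c) (rep d)))), cls.
split=> [||a b]; last exact: clsE.
- by split=> a b; apply/clsE; [apply: RD | apply: RM]; apply: Rsym.
- by move=> c; exists (rep c); exact: repE.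
Qed.

Lemma quotient_validP (A B : algebra) (R : A -> A -> Prop) (q : A -> B) s t :
  quotient_map R q ->
  valid B s t <-> forall v : nat -> A, R (eval v s) (eval v t).
Proof.
case=> qhom qsurj qE; split=> [Bst v | Rst v].
  by apply/qE; rewrite !eval_morph // Bst.
have [w qw] := lift_valuation v qsurj.
by rewrite -!(eq_eval _ qw) -!eval_morph //; apply/qE.
Qed.

(** One half of Birkhoff's theorem.  [B] is the image of the algebra of those
    functions on [A ^ B] that terms in the elements of [B] induce: the value in
    [B] of such a term depends only on the function, as equality of two of these
    functions is an identity of [A]. *)
Lemma birkhoff (A B : algebra) :
  (forall s t, valid A s t -> valid B s t) -> generated_variety A B.
Proof.
move=> AB V Vvar VA.
have sep (e : nat -> B) s t :
    (forall phi : B -> A,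
       eval (fun n => phi (e n)) s = eval (fun n => phi (e n)) t) ->
    eval e s = eval e t.
  move=> st.
  (* Variables with the same value in B are identified, so that every valuation
     in A comes from a function on B. *)
  pose first (b : B) := epsilon (inhabits 0) (fun n => e n = b).
  have eK n : e (first (e n)) = e n.
    exact: (epsilon_spec (inhabits 0) (fun m => e m = e n) (ex_intro _ n erefl)).
  pose r n := Var (first (e n)).
  have Ast : valid A (subst r s) (subst r t).
    by move=> v; rewrite !eval_subst /=; exact: (st (fun b => v (first b))).
  by have := AB _ _ Ast e; rewrite !eval_subst /= !(eq_eval _ eK).
pose F := product_algebra (fun _ : B -> A => A).
pose fn (te : term * (nat -> B)) : F :=
  fun phi => eval (fun n => phi (te.2 n)) te.1.
pose val (te : term * (nat -> B)) := eval te.2 te.1.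
(* Two terms under two valuations are put under a common one, on the even and
   on the odd variables. *)
pose mix (e1 e2 : nat -> B) n := if odd n then e2 n./2 else e1 n./2.
pose evn := subst (fun n => Var n.*2); pose od := subst (fun n => Var n.*2.+1).
have evnE (C : algebra) (phi : B -> C) e1 e2 t :
    eval (fun n => phi (mix e1 e2 n)) (evn t) = eval (fun n => phi (e1 n)) t.
  rewrite eval_subst; apply: eq_eval => n /=.
  by rewrite /mix odd_double doubleK.
have odE (C : algebra) (phi : B -> C) e1 e2 t :
    eval (fun n => phi (mix e1 e2 n)) (od t) = eval (fun n => phi (e2 n)) t.
  rewrite eval_subst; apply: eq_eval => n /=.
  by rewrite /mix /= odd_double uphalf_double.
have fn_val te1 te2 : fn te1 = fn te2 -> val te1 = val te2.
  case: te1 te2 => [t1 e1] [t2 e2] eq12.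
  rewrite /val /= -(@evnE _ id e1 e2) -(@odE _ id e1 e2); apply: sep => phi.
  by rewrite (evnE A) (odE A); exact: (f_equal (fun f => f phi) eq12).
pose S := {g : F | exists te, g = fn te}.
have S_eq (g h : S) : proj1_sig g = proj1_sig h -> g = h.
  by move=> gh; apply: eq_sig_hprop => // C p p'; exact: proof_irrelevance.
pose tms (g : S) := constructive_indefinite_description _ (proj2_sig g).
pose f (g : S) : B := val (proj1_sig (tms g)).
have fE g te : proj1_sig g = fn te -> f g = val te.
  by move=> gte; apply: fn_val; rewrite -gte; exact: esym (proj2_sig (tms g)).
pose join op (te1 te2 : term * (nat -> B)) :=
  (op (evn te1.1) (od te2.1), mix te1.2 te2.2) : term * (nat -> B).
have joinD te1 te2 : add (fn te1) (fn te2) = fn (join Add te1 te2).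
  by apply: functional_extensionality => phi; rewrite /fn /= (evnE A) (odE A).
have joinM te1 te2 : mul (fn te1) (fn te2) = fn (join Mul te1 te2).
  by apply: functional_extensionality => phi; rewrite /fn /= (evnE A) (odE A).
have addP (g h : S) : exists te, add (proj1_sig g) (proj1_sig h) = fn te.
  have [te1 ->] := proj2_sig g; have [te2 ->] := proj2_sig h.
  by rewrite joinD; exists (join Add te1 te2).
have mulP (g h : S) : exists te, mul (proj1_sig g) (proj1_sig h) = fn te.
  have [te1 ->] := proj2_sig g; have [te2 ->] := proj2_sig h.
  by rewrite joinM; exists (join Mul te1 te2).
pose elt te : S := exist _ (fn te) (ex_intro _ te erefl).
pose SA := Algebra (elt (Var 0, fun=> witness B))
  (fun g h : S => exist _ _ (addP g h)) (fun g h : S => exist _ _ (mulP g h)).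
have VF : V F by apply: (variety_P Vvar).
have VS : V SA.
  by apply: (variety_S Vvar (A := F) (B := SA) (f := @proj1_sig _ _) _ S_eq VF).
apply: (variety_H Vvar (A := SA) (f := f)) VS; last first.
  by move=> b; exists (elt (Var 0, fun=> b)); rewrite (fE _ (Var 0, fun=> b)).
split=> g h; have [te1 g1] := proj2_sig g; have [te2 h2] := proj2_sig h;
  rewrite (fE g te1) // (fE h te2) //.
- rewrite (fE _ (join Add te1 te2)) /=; last by rewrite g1 h2; exact: joinD.
  by rewrite /val /= (evnE B id) (odE B id).
- rewrite (fE _ (join Mul te1 te2)) /=; last by rewrite g1 h2; exact: joinM.
  by rewrite /val /= (evnE B id) (odE B id).
Qed.

(** Compactness, by a reduced product: if the subvariety defined by all [e n]
    had a finite basis, the reduced product of the [A n] along the cofinite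
    filter would satisfy that basis, hence so would some [A n], which violates
    [e n]. *)
Lemma not_hereditarily_finitely_based (V : algebra_class)
    (e : nat -> identity) (A : nat -> algebra) :
  is_variety V -> (forall n, V (A n)) ->
  (forall m n, m < n -> satisfies (A n) (e m)) ->
  (forall n, ~ satisfies (A n) (e n)) ->
  ~ hereditarily_finitely_based V.
Proof.
move=> Vvar VA Ae nAe hfb.
pose U B := V B /\ forall n, satisfies B (e n).
have [|Sigma SigmaP] := hfb U.
  split=> [|B []//]; apply: variety_and => //.
  by apply: variety_inter => n; exact: satisfies_variety.
pose F := product_algebra A.
pose R (f g : F) := exists N, forall n, N <= n -> f n = g n.
have congR : congruence R.
  split=> [f | f g [N fg] | f g h [M fg] [N gh]
         | f f' g g' [M ff] [N gg] | f f' g g' [M ff] [N gg]].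
  - by exists 0.
  - by exists N => n /fg.
  - by exists (maxn M N) => n; rewrite geq_max => /andP[/fg-> /gh->].
  - by exists (maxn M N) => n; rewrite geq_max /= => /andP[/ff-> /gg->].
  - by exists (maxn M N) => n; rewrite geq_max /= => /andP[/ff-> /gg->].
have [B [q qB]] := quotient_exists congR.
have UB : U B.
  split; first by apply: (variety_H Vvar (quot_hom qB) (quot_surj qB));
    apply: (variety_P Vvar).
  move=> m; apply/(quotient_validP _ _ qB) => v.
  by exists m.+1 => n /Ae An; rewrite !eval_product An.
have eventually i : List.In i Sigma ->
    exists N, forall n, N <= n -> satisfies (A n) i.
  move=> iS; apply: NNPP => never.
  pose bad n (w : nat -> A n) := eval w (lhs i) <> eval w (rhs i).
  pose w n : nat -> A n := epsilon (inhabits (fun=> witness (A n))) (bad n).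
  have := (SigmaP B).1 UB i iS; move/(quotient_validP _ _ qB).
  case/(_ (fun k n => w n k)) => N eqN; apply: never; exists N => n leNn.
  move: (eqN n leNn); rewrite !eval_product => eqn v; apply: NNPP => vbad.
  exact: (epsilon_spec (inhabits (fun=> witness (A n))) (bad n)
            (ex_intro _ v vbad) eqn).
have [N NP] : exists N, forall i, List.In i Sigma -> satisfies (A N) i.
  suff [N NP] : exists N, forall n, N <= n ->
      forall i, List.In i Sigma -> satisfies (A n) i by exists N; apply: NP.
  elim: {SigmaP} Sigma eventually => [|i Sigma IH] ev; first by exists 0.
  have [|M MP] := IH; first by move=> j jS; apply: ev; right.
  have [|N NP] := ev i; first by left.
  exists (maxn M N) => n; rewrite geq_max => /andP[leM leN] j [<-|jS].
    exact: NP.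
  exact: MP.
by apply: (nAe N); exact: ((SigmaP (A N)).2 NP).2 N.
Qed.

(** * Terms as lists of words *)

(** Giving a variable a list of words instead of one letter describes the words
    of all the instances of [t] at once. *)
Fixpoint monos (tau : nat -> seq (seq nat)) (t : term) : seq (seq nat) :=
  match t with
  | Var i => tau i
  | Add s t => monos tau s ++ monos tau t
  | Mul s t => [seq u ++ w | u <- monos tau s, w <- monos tau t]
  end.

Definition words (t : term) : seq (seq nat) :=
  monos (fun i => [:: [:: i]]) t.

Lemma words_Add s t : words (Add s t) = words s ++ words t.
Proof. by []. Qed.

Lemma words_subst sigma t :
  words (subst sigma t) = monos (fun i => words (sigma i)) t.
Proof.
by elim: t => //= s IHs t IHt;
  rewrite /subst /= -!/(subst _ _) /words /= -!/(words _) IHs IHt.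
Qed.

Lemma monos_neq0 tau t : (forall i, tau i != [::]) -> monos tau t != [::].
Proof.
move=> tau0; elim: t => [i|s IHs t IHt|s IHs t IHt] //=.
  by case: (monos tau s) IHs.
by case: (monos tau s) IHs => // u us _; case: (monos tau t) IHt.
Qed.

Lemma words_neq0 t : words t != [::].
Proof. exact: monos_neq0. Qed.

Lemma words_nonnil t u : u \in words t -> u != [::].
Proof.
rewrite /words; elim: t u => [i|s IHs t IHt|s IHs t IHt] u /=.
- by rewrite inE => /eqP->.
- by rewrite mem_cat => /orP[/IHs | /IHt].
- by case/allpairsP => -[a b] /= [/IHs + _ ->]; case: a.
Qed.

Lemma flatten_mem_monos tau (pick : nat -> seq nat) t u :
  (forall i, pick i \in tau i) -> u \in words t ->
  flatten [seq pick i | i <- u] \in monos tau t.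
Proof.
move=> pickP; rewrite /words; elim: t u => [i|s IHs t IHt|s IHs t IHt] u /=.
- by rewrite inE => /eqP-> /=; rewrite cats0.
- by rewrite !mem_cat => /orP[/IHs-> | /IHt->]; rewrite ?orbT.
- case/allpairsP => -[a b] /= [/IHs sa /IHt tb ->].
  by rewrite map_cat flatten_cat; apply: allpairs_f.
Qed.

(** * Evaluation in the max-plus algebra *)

Definition weight (v : nat -> nat) (u : seq nat) : nat := \sum_(i <- u) v i.

Lemma weight_cat v u w : weight v (u ++ w) = weight v u + weight v w.
Proof. exact: big_cat. Qed.

Lemma weight_cons v i u : weight v (i :: u) = v i + weight v u.
Proof. exact: big_cons. Qed.

Lemma perm_weight v u w : perm_eq u w -> weight v u = weight v w.
Proof. by move=> uw; exact: perm_big. Qed.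

Lemma leq_weight v u w :
  (forall j, count_mem j u <= count_mem j w) -> weight v u <= weight v w.
Proof.
move/count_subseqP => [u' /subseqP[m _ ->] /perm_weight->].
elim: w m => [|i w IH] [|[] m] //=; rewrite ?weight_cons ?leq_add2l //.
  by rewrite /weight big_nil.
by apply: leq_trans (IH m) (leq_addl _ _).
Qed.

Lemma weight_count j u : weight (fun i => i == j) u = count_mem j u.
Proof.
by elim: u => [|i u IH]; rewrite ?weight_cons /= ?IH // /weight big_nil.
Qed.

Definition greatest_weight (v : nat -> nat) (us : seq (seq nat)) (c : nat) :=
  (forall u, u \in us -> weight v u <= c) /\
  exists2 u, u \in us & weight v u = c.

Lemma greatest_weight_monos v tau (f : nat -> nat) t :
  (forall i, greatest_weight v (tau i) (f i)) ->
  greatest_weight v (monos tau t) (eval (A := algN) f t).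
Proof.
move=> tauf; elim: t => [i|s [les [u su uE]] t [let_ [w tw wE]]|
                         s [les [u su uE]] t [let_ [w tw wE]]] /=.
- exact: tauf.
- split=> [a|].
    rewrite mem_cat leq_max => /orP[/les-> // | /let_->]; exact: orbT.
  case: (leqP (eval (A := algN) f s) (eval (A := algN) f t)) => _.
    by exists w; rewrite ?mem_cat ?tw ?orbT.
  by exists u; rewrite ?mem_cat ?su.
- split=> [a /allpairsP[[b c] /= [/les leb /let_ lec ->]]|].
    by rewrite weight_cat leq_add.
  by exists (u ++ w); rewrite ?weight_cat ?uE ?wE //; apply: allpairs_f.
Qed.

Lemma exists_greatest_weight v us :
  us != [::] -> exists c, greatest_weight v us c.
Proof.
elim: us => // a [_ _ | b us /(_ isT) [c [lec [u us_u uE]]] _].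
  by exists (weight v a); split=> [u|]; [rewrite inE => /eqP-> | exists a;
    rewrite ?inE].
case: (leqP (weight v a) c) => ac.
  exists c; split=> [w|]; first by rewrite inE => /orP[/eqP->|/lec].
  by exists u => //; rewrite inE us_u orbT.
exists (weight v a); split=> [w|]; last by exists a; rewrite ?inE ?eqxx.
by rewrite inE => /orP[/eqP->|/lec /leq_trans->] //; exact: ltnW.
Qed.

(** Both sides of a valid identity have the same largest weight, when a variable
    [i] takes as its value the largest weight of a word in [tau i]. *)
Lemma valid_dominates s t tau v u :
  valid algN s t -> (forall i, tau i != [::]) -> u \in monos tau t ->
  exists2 w, w \in monos tau s & weight v u <= weight v w.
Proof.
move=> st tau0 tu.
pose cP i := constructive_indefinite_description _
  (exists_greatest_weight v (tau0 i)).
have tauf i : greatest_weight v (tau i) (proj1_sig (cP i)) by case: (cP i).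
have [_ [w sw wE]] := greatest_weight_monos s tauf.
exists w => //; rewrite wE st.
by have [le_t _] := greatest_weight_monos t tauf; exact: le_t.
Qed.

Lemma words_dominate s t v u :
  valid algN s t -> u \in words t ->
  exists2 w, w \in words s & weight v u <= weight v w.
Proof. by move=> st tu; apply: (valid_dominates v st). Qed.

(** The converse for [words]: the value of a term is the largest weight of its
    words. *)
Lemma words_valid s t :
  (forall v u, u \in words s ->
     exists2 w, w \in words t & weight v u <= weight v w) ->
  (forall v u, u \in words t ->
     exists2 w, w \in words s & weight v u <= weight v w) ->
  valid algN s t.
Proof.
move=> st ts v.
have vP i : greatest_weight v [:: [:: i]] (v i).
  split=> [u|]; first by rewrite inE => /eqP->; rewrite /weight big_seq1.
  by exists [:: i]; rewrite ?inE // /weight big_seq1.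
have [les [u su uE]] := greatest_weight_monos s vP.
have [let_ [w tw wE]] := greatest_weight_monos t vP.
apply/eqP; rewrite eqn_leq -{1}uE -{2}wE; apply/andP; split.
  by have [a /let_ /[swap]] := st v u su; exact: leq_trans.
by have [a /les /[swap]] := ts v w tw; exact: leq_trans.
Qed.

(** * A finite basis of [W 2] *)

Definition W2_basis : seq identity :=
  comm_ai_semiring_axioms ++ [:: x * y + x ≈ x * y; x ^ 2 + z ≈ x ^ 2].

Record W2_laws (A : algebra) : Prop := W2Laws {
  W2_addA : associative (@add A);
  W2_addC : commutative (@add A);
  W2_addxx : idempotent_op (@add A);
  W2_mulA : associative (@mul A);
  W2_mulC : commutative (@mul A);
  W2_mulDr : right_distributive (@mul A) (@add A);
  W2_absorb : forall a b : A, add (mul a b) a = mul a b;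
  W2_top : forall a b : A, add (mul a a) b = mul a a
}.

Lemma W2_lawsP (A : algebra) :
  (forall e, List.In e W2_basis -> satisfies A e) <-> W2_laws A.
Proof.
split=> [H | [addA addC addxx mulA mulC mulDr absorb top] e].
  have law k : k < size W2_basis -> satisfies A (nth (x ≈ x) W2_basis k).
    move=> lt_k; apply: H; elim: W2_basis k lt_k => // e s IH [|k] //= lt_k.
      by left.
    by right; apply: IH.
  pose v a b c := nth a [:: a; b; c] : nat -> A.
  split=> [a b c|a b|a|a b c|a b|a b c|a b|a b].
  - exact: esym (law 0 isT (v a b c)).
  - exact: (law 1 isT (v a b a)).
  - exact: (law 2 isT (v a a a)).
  - exact: esym (law 3 isT (v a b c)).
  - exact: (law 6 isT (v a b a)).
  - exact: (law 4 isT (v a b c)).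
  - exact: (law 7 isT (v a b a)).
  - exact: (law 8 isT (v a a b)).
case=> [<-|]; first by move=> v /=; rewrite addA.
case=> [<-|]; first by move=> v; exact: addC.
case=> [<-|]; first by move=> v; exact: addxx.
case=> [<-|]; first by move=> v /=; rewrite mulA.
case=> [<-|]; first by move=> v; exact: mulDr.
case=> [<-|]; first by move=> v /=; rewrite ![mul _ (v 2)]mulC; exact: mulDr.
case=> [<-|]; first by move=> v; exact: mulC.
case=> [<-|]; first by move=> v; exact: absorb.
by case=> [<- v|[]]; exact: top.
Qed.

(** Words take their values in [A] with a unit [None] adjoined, so that the
    empty word, which arises as the complement of a subword, has a value too. *)
Definition word_val (A : algebra) (H : W2_laws A) (v : nat -> A) (u : seq nat) :
    option A :=
  \big[oAC (W2_mulA H) (W2_mulC H)/None]_(i <- u) Some (v i).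

(** The order of the idempotent addition; the adjoined unit is put below
    everything, as multiplication is inflationary. *)
Definition below (A : algebra) (a : option A) (c : A) : Prop :=
  if a is Some b then add b c = c else True.

Lemma below_trans (A : algebra) (H : W2_laws A) (a : option A) b c :
  below a b -> add b c = c -> below a c.
Proof. by case: a => //= a ab bc; rewrite -bc (W2_addA H) ab. Qed.

Lemma below_mul (A : algebra) (H : W2_laws A) (a : A) (o : option A) :
  if oAC (W2_mulA H) (W2_mulC H) (Some a) o is Some b then add a b = b else False.
Proof.
by case: o => [b|]; rewrite /oAC /= ?(W2_addxx H) // (W2_addC H) (W2_absorb H).
Qed.

Lemma words_below (A : algebra) (H : W2_laws A) (v : nat -> A) t u :
  u \in words t -> exists2 a,
    word_val H v u = Some a & add a (eval v t) = eval v t.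
Proof.
have addA := W2_addA H; have addC := W2_addC H; have mulC := W2_mulC H.
have mulDr := W2_mulDr H; have addxx := W2_addxx H.
rewrite /words /word_val; elim: t u => [i|s IHs t IHt|s IHs t IHt] u /=.
- by rewrite inE => /eqP->; exists (v i); rewrite ?big_seq1 ?addxx.
- rewrite mem_cat => /orP[/IHs | /IHt] [a -> alt]; exists a => //.
    by rewrite addA alt.
  by rewrite addC -addA [add _ a]addC alt.
- case/allpairsP => -[b c] /= [/IHs[a aE alt] /IHt[d dE dlt] ->].
  exists (mul a d); first by rewrite big_cat /= aE dE.
  have ad_aT : add (mul a d) (mul a (eval v t)) = mul a (eval v t).
    by rewrite -mulDr dlt.
  have aT_ST : add (mul a (eval v t)) (mul (eval v s) (eval v t)) =
               mul (eval v s) (eval v t).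
    by rewrite ![mul _ (eval v t)]mulC -mulDr alt.
  by rewrite -aT_ST addA ad_aT.
Qed.

(** The value of a term is the join of the values of its words.  The factor [o]
    makes the induction go through products: for [Mul s t], the value of one
    factor becomes part of the [o] of the other. *)
Lemma eval_least (A : algebra) (H : W2_laws A) (v : nat ->
  A) t (o : option A) c :
  (forall u, u \in words t ->
     below (oAC (W2_mulA H) (W2_mulC H) (word_val H v u) o) c) ->
  below (oAC (W2_mulA H) (W2_mulC H) (Some (eval v t)) o) c.
Proof.
set mulo := oAC _ _; rewrite /words.
have muloA : associative mulo by exact: Monoid.mulmA.
have muloCA : left_commutative mulo by exact: Monoid.mulmCA.
elim: t o => [i|s IHs t IHt|s IHs t IHt] o /= le_c.
- by have := le_c [:: i]; rewrite inE eqxx /word_val big_seq1; apply.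
- have {}IHs : below (mulo (Some (eval v s)) o) c.
    by apply: IHs => u su; apply: le_c; rewrite mem_cat su.
  have {}IHt : below (mulo (Some (eval v t)) o) c.
    by apply: IHt => u su; apply: le_c; rewrite mem_cat su orbT.
  case: o IHs IHt {le_c} => [b|] /= hs ht; last first.
    by rewrite -(W2_addA H) ht hs.
  rewrite (W2_mulC H) (W2_mulDr H) ![mul b _](W2_mulC H).
  by rewrite -(W2_addA H) ht hs.
- have -> : Some (mul (eval v s) (eval v t)) =
            mulo (Some (eval v s)) (Some (eval v t)) by [].
  rewrite -muloA; apply: IHs => u su.
  rewrite muloCA; apply: IHt => w tw; rewrite muloCA muloA.
  have := le_c (u ++ w); rewrite /word_val big_cat /=; apply.
  exact: allpairs_f.
Qed.

Lemma perm_repeated (T : eqType) (s : seq T) :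
  ~~ uniq s -> exists a r, perm_eq s (a :: a :: r).
Proof.
elim: s => //= b s IH; case: (boolP (b \in s)) => [bs _|_ /IH[a [r sr]]].
  by exists b, (rem b s); rewrite perm_cons perm_to_rem.
exists a, (b :: r); apply: (@perm_trans _ (b :: a :: a :: r)).
  by rewrite perm_cons.
exact: (permEl (perm_catCA [:: b] [:: a; a] r)).
Qed.

(** Let [u] be a word of [t].  Either some word of [s] has a repeated letter,
    and the value of [s] is the top element; or all words of [s] are square
    free, and the indicator function of the letters of [u] shows that [u] is
    square free and that one of the words of [s] contains it. *)
Lemma W2_valid_le (A : algebra) (H : W2_laws A) s t (v : nat -> A) :
  valid algN s t -> add (eval v t) (eval v s) = eval v s.
Proof.
move=> st; pose mulo := oAC (W2_mulA H) (W2_mulC H).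
have muloA : associative mulo by exact: Monoid.mulmA.
suff le_s u : u \in words t -> below (mulo (word_val H v u) None) (eval v s).
  exact: (eval_least le_s).
rewrite [mulo _ _]Monoid.mulm1 => tu.
have [all_uniq|/allPn[w sw]] := boolP (all uniq (words s)); last first.
  case/perm_repeated => a [r wr].
  have [b wE b_s] := words_below H v sw.
  have {}wE : mulo (Some (mul (v a) (v a))) (word_val H v r) = Some b.
    rewrite -wE /word_val (perm_big _ wr) !big_cons /=.
    by rewrite -/mulo muloA.
  have := below_mul H (mul (v a) (v a)) (word_val H v r);
    rewrite -/mulo wE => le_b.
  have top_s c : add c (eval v s) = eval v s.
    rewrite -b_s -le_b -!(W2_addA H) [X in add c X](W2_top H).
    by rewrite (W2_addC H) !(W2_top H).
  by case: (word_val H v u) => /=.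
pose chi i : nat := i \in u.
have [w sw le_w] := words_dominate chi st tu.
have w_uniq := allP all_uniq w sw.
have chi_u : weight chi u = size u.
  rewrite /weight (eq_big_seq (fun=> 1)) ?sum1_size // => i.
  by rewrite /chi => ->.
have chi_w : weight chi w = count [in u] w.
  by rewrite /weight -sum1_count [RHS]big_mkcond; apply: eq_bigr => i _;
    rewrite /chi /=; case: ifP.
have sub_uw : perm_eq u (filter [in u] w).
  rewrite perm_sym.
  have fu : uniq (filter [in u] w) by rewrite filter_uniq.
  have sub : {subset filter [in u] w <= u} by move=> i;
    rewrite mem_filter => /andP[].
  have le_size : size u <= size (filter [in u] w).
    by rewrite size_filter -chi_w -chi_u.
  have [szE eq_mem] := uniq_min_size fu sub le_size.
  apply: uniq_perm => //.
  by rewrite -(eq_uniq szE eq_mem).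
have [b wE b_s] := words_below H v sw.
apply: (below_trans H _ b_s).
move: wE; rewrite /word_val (perm_big _ sub_uw).
rewrite -(perm_big _ (permEl (perm_filterC [in u] w))) big_cat /=.
rewrite -!/(word_val H v _) -/mulo.
case: (word_val H v [seq i <- w | i \in u]) => //= a wE.
by have := below_mul H a (word_val H v (filter (predC [in u]) w));
  rewrite -/mulo wE.
Qed.

Lemma W2_valid (A : algebra) s t : W2_laws A -> valid algN s t -> valid A s t.
Proof.
move=> H st v; rewrite -(W2_valid_le H v st).
by rewrite (W2_addC H) (W2_valid_le H).
Qed.

Lemma W2_defined_by : defined_by (W 2) W2_basis.
Proof.
move=> A; rewrite W2_lawsP; split=> [[MA topA] | H].
  apply/W2_lawsP => e.
  have NA s t : valid algN s t -> satisfies A (Identity s t).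
    exact: generated_variety_valid.
  by do 8![case=> [<-|]; first by apply: NA => v /=; lia]; case=> [<-|[]].
split; first by apply: birkhoff => s t; exact: W2_valid.
by move=> v; rewrite /= (W2_top H).
Qed.

(** * The syntactic algebra of a set of words *)

Definition fits (P : seq nat -> Prop) (w : seq nat) (t : term) : Prop :=
  forall u, u \in words t -> P (w ++ u).

(** The syntactic congruence of the terms all of whose words are in [P]. *)
Definition same_fit (P : seq nat -> Prop) (s t : term) : Prop :=
  forall w, fits P w s <-> fits P w t.

Definition perm_closed (P : seq nat -> Prop) : Prop :=
  forall u w, perm_eq u w -> P u -> P w.

Lemma fits_add P w s t : fits P w (Add s t) <-> fits P w s /\ fits P w t.
Proof.
split=> [H|[Hs Ht] u]; last by rewrite /words mem_cat => /orP[/Hs|/Ht].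
by split=> u tu; apply: H; rewrite /words mem_cat tu ?orbT.
Qed.

Lemma fits_mul P w s t :
  fits P w (Mul s t) <-> forall u, u \in words s -> fits P (w ++ u) t.
Proof.
split=> [H u su a ta | H u /allpairsP[[a b] /= [sa tb ->]]].
  by rewrite -catA; apply: H; exact: allpairs_f.
by rewrite catA; exact: H.
Qed.

Lemma fits_mulC P w s t :
  perm_closed P -> fits P w (Mul s t) <-> fits P w (Mul t s).
Proof.
move=> Pperm; rewrite !fits_mul.
by split=> H u su a ta; move: (H a ta u su); apply: Pperm;
  rewrite -!catA perm_cat2l perm_catC.
Qed.

Lemma same_fit_congruence P :
  perm_closed P -> congruence (A := term_algebra) (same_fit P).
Proof.
move=> Pperm.
have mulr s t t' : same_fit P t t' -> same_fit P (Mul s t) (Mul s t').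
  by move=> tt' w; rewrite !fits_mul; split=> H u /H /tt'.
split=> [s w|s t st w|s t r st tr w|s s' t t' ss' tt' w|s s' t t' ss' tt' w] //=.
- by rewrite st.
- by rewrite st tr.
- by rewrite !fits_add ss' tt'.
- rewrite (mulr _ _ _ tt' w) fits_mulC // (mulr _ _ _ ss' w).
  exact: fits_mulC.
Qed.

(** Valuations in the quotient are substitutions read up to [same_fit]. *)
Lemma syntactic_algebra P : perm_closed P ->
  exists B, forall s t,
    valid B s t <-> forall sigma, same_fit P (subst sigma s) (subst sigma t).
Proof.
move=> /same_fit_congruence congP.
have [B [q qB]] := quotient_exists congP.
by exists B => s t; exact: (quotient_validP s t qB).
Qed.

(** Heredity of the set [P] gives absorption.  A square of a term has words with
    repeated letters, so no context makes it fit, which is what it means to be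
    the top element. *)
Lemma syntactic_algebra_W2 P B : perm_closed P ->
  (forall u w, P (u ++ w) -> P u) -> (forall u, P u -> uniq u) ->
  (forall s t, valid B s t <->
     forall sigma, same_fit P (subst sigma s) (subst sigma t)) ->
  W 2 B.
Proof.
move=> Pperm Ppre Puniq BP; apply/(W2_defined_by B) => e.
case=> [<-|]; first by apply/BP => f w; rewrite !fits_add; tauto.
case=> [<-|]; first by apply/BP => f w; rewrite !fits_add; tauto.
case=> [<-|]; first by apply/BP => f w; rewrite !fits_add; tauto.
case=> [<-|].
  apply/BP => f w; rewrite !fits_mul; split=> H u fu.
    by apply/fits_mul => a fa; rewrite -catA; apply: H; exact: allpairs_f.
  case/allpairsP: fu => -[a b] /= [fa fb ->].
  by rewrite catA; have /fits_mul := H a fa; exact.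
case=> [<-|].
  apply/BP => f w; rewrite fits_add !fits_mul.
  split=> [H|[H1 H2] u fu]; last by apply/fits_add; split;
    [apply: H1|apply: H2].
  by split=> u fu; have /fits_add[] := H u fu.
case=> [<-|].
  apply/BP => f w; rewrite fits_add !fits_mul.
  split=> [H|[H1 H2] u].
    by split=> u fu; apply: H; rewrite /words mem_cat fu ?orbT.
  by rewrite /words mem_cat => /orP[/H1|/H2].
case=> [<-|]; first by apply/BP => f w; exact: fits_mulC.
case=> [<-|].
  apply/BP => f w; rewrite fits_add fits_mul; split=> [[]//|H]; split=> // u fu.
  have [b fb] : exists b, b \in words (f 1).
    by case: (words (f 1)) (words_neq0 (f 1)) => // b s _; exists b;
      rewrite inE eqxx.
  exact: (Ppre _ b (H u fu b fb)).
case=> [<-|[]].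
apply/BP => f w.
suff no_fit : ~ fits P w (Mul (f 0) (f 0)).
  by rewrite fits_add; split=> [[]//|H]; case: no_fit.
move/fits_mul => H.
have [b fb] : exists b, b \in words (f 0).
  by case: (words (f 0)) (words_neq0 (f 0)) => // b s _; exists b;
    rewrite inE eqxx.
have /Puniq := H b fb b fb;
  rewrite -catA cat_uniq cat_uniq => /and3P[_ _ /and3P[_]].
by case: b {fb} (words_nonnil fb) => // c b _; rewrite /= inE eqxx.
Qed.

(** * Odd cycles: a subvariety of [W 2] without finite basis *)

Definition sum_term (t : term) (ts : seq term) : term := foldr Add t ts.

Lemma words_sum_term t ts :
  words (sum_term t ts) = flatten (map words ts) ++ words t.
Proof. by elim: ts => //= s ts IH;
  rewrite {1}/words /= -!/(words _) IH catA. Qed.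

(** The edges of the cycle of length [m.+1] on the variables [0], ..., [m]. *)
Definition cycle_term (m : nat) : term :=
  sum_term (Mul (Var m) (Var 0)) [seq Mul (Var i) (Var i.+1) | i <- iota 0 m].

Lemma words_cycle_term m :
  words (cycle_term m) = rcons [seq [:: i; i.+1] | i <- iota 0 m] [:: m; 0].
Proof.
rewrite words_sum_term -map_comp cats1; congr rcons.
by elim: (iota 0 m) => //= i s ->.
Qed.

(** Adjacency in the cycle of length [n], whose vertices are the residues modulo
    [n]: each vertex is represented by all numbers in its class. *)
Definition cyclic_adj (n : nat) : rel nat :=
  [rel i j | (i.+1 == j %[mod n]) || (j.+1 == i %[mod n])].

(** A walk with [p] steps forward and [q] steps back ends [p - q] further; a
    closed walk shorter than [n] thus has [p = q] and even length. *)
Lemma no_short_odd_walk n m (c : nat -> nat) :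
  ~~ odd m -> m.+1 < n -> (forall i, i < m -> cyclic_adj n (c i) (c i.+1)) ->
  ~~ cyclic_adj n (c m) (c 0).
Proof.
move=> even_m lt_mn walk.
have pos i : i <= m -> exists p q,
    p + q = i /\ c i + q = c 0 + p %[mod n].
  elim: i => [|i IH] lt_im; first by exists 0, 0.
  have [p [q [pq E]]] := IH (ltnW lt_im).
  case/orP: (walk i lt_im) => /eqP step.
    exists p.+1, q; split; first by rewrite addSn pq.
    rewrite -modnDml -step modnDml addSn addnS -!(addn1 (_ + _)).
    by rewrite -modnDml E modnDml.
  exists p, q.+1; split; first by rewrite addnS pq.
  by rewrite addnS -addSn -modnDml step modnDml.
have [p [q [pq E]]] := pos m (leqnn m).
have small a b : a < n -> b < n -> c 0 + a = c 0 + b %[mod n] -> a = b.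
  by move=> an bn /eqP; rewrite eqn_modDl !modn_small // => /eqP.
apply/negP => /orP[] /eqP step.
- have /small E1 : c 0 + q = c 0 + p.+1 %[mod n].
    rewrite -modnDml -step modnDml addSn addnS -!(addn1 (_ + _)).
    by rewrite -modnDml E modnDml.
  have {}E1 : q = p.+1 by apply: E1; lia.
  by move: even_m; rewrite -pq E1 addnS oddS oddD addbb.
- have /small E1 : c 0 + q.+1 = c 0 + p %[mod n].
    by rewrite addnS -addSn -modnDml step modnDml.
  have {}E1 : q.+1 = p by apply: E1; lia.
  by move: even_m; rewrite -pq -E1 addSn oddS oddD addbb.
Qed.

(** As squares are top in [W 2], this identity says there that the cycle of
    length [j.*2.+3] is top. *)
Definition odd_cycle_identity (j : nat) : identity :=
  Identity (cycle_term j.*2.+2)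
    (Add (cycle_term j.*2.+2) (Mul (Var 0) (Var 0))).

(** Taking all cliques, not only the edges, makes this set of words hereditary
    without a condition on their length. *)
Definition clique (n : nat) (u : seq nat) : Prop :=
  uniq u /\ {in u &, forall i j, i != j -> cyclic_adj n i j}.

Lemma clique_perm n : perm_closed (clique n).
Proof.
move=> u w uw [u_uniq u_adj]; split; first by rewrite -(perm_uniq uw).
by move=> i j; rewrite -!(perm_mem uw); exact: u_adj.
Qed.

Lemma clique_prefix n u w : clique n (u ++ w) -> clique n u.
Proof.
case; rewrite cat_uniq => /andP[u_uniq _] u_adj; split=> // i j iu ju.
by apply: u_adj; rewrite mem_cat ?iu ?ju.
Qed.

(** If a substitution turns all edges of a cycle into cliques, then choosing one
    letter in the image of each variable maps that cycle to a closed walk. *)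
Lemma odd_cycle_fits_no_clique n m w sigma :
  ~~ odd m -> m.+1 < n -> ~ fits (clique n) w (subst sigma (cycle_term m)).
Proof.
move=> even_m lt_mn fit.
pose pick i := head [::] (words (sigma i)).
have pickP i : pick i \in words (sigma i).
  by rewrite /pick; case: (words _) (words_neq0 (sigma i)) => //= a s _;
    rewrite inE eqxx.
pose c i := head 0 (pick i).
have c_pick i : c i \in pick i.
  by rewrite /c; case: (pick i) (words_nonnil (pickP i)) => //= a s _;
    rewrite inE eqxx.
have edge i j : [:: i; j] \in words (cycle_term m) -> cyclic_adj n (c i) (c j).
  move=> /(flatten_mem_monos pickP) /=; rewrite cats0 -words_subst => /fit.
  case; rewrite cat_uniq => /and3P[_ _]; rewrite cat_uniq => /and3P[_ ij _] adj.
  apply: adj; rewrite ?mem_cat ?c_pick ?orbT //.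
  by apply: contraNneq ij => cij; apply/hasP; exists (c j);
    rewrite // -cij c_pick.
suff /negP[] : ~~ cyclic_adj n (c m) (c 0).
  by apply: edge; rewrite words_cycle_term mem_rcons inE eqxx.
apply: no_short_odd_walk => // i lt_im; apply: edge.
rewrite words_cycle_term mem_rcons inE; apply/orP; right.
by apply: map_f; rewrite mem_iota.
Qed.

Lemma cycle_term_fits_clique m :
  0 < m -> fits (clique m.+1) [::] (cycle_term m).
Proof.
move=> m_gt0 u.
have edge i j : i != j -> i.+1 = j %[mod m.+1] -> clique m.+1 [:: i; j].
  move=> ij step; split=> [|a b]; first by rewrite /= inE ij.
  by rewrite !inE => /orP[] /eqP-> /orP[] /eqP->; rewrite ?eqxx // => _;
    apply/orP; rewrite step; by [left | right].
rewrite words_cycle_term mem_rcons inE => /orP[/eqP->|/mapP[i _ ->]].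
  by apply: edge; rewrite ?modnn // -lt0n.
by apply: edge; rewrite // neq_ltn ltnSn.
Qed.

(** The algebra with index [j] is the syntactic algebra for the cycle of length
    [j.*2.+3]: it refutes the identity of that cycle and satisfies those of the
    shorter ones. *)
Lemma W2_not_hereditarily_finitely_based : ~ hereditarily_finitely_based (W 2).
Proof.
have W2_variety : is_variety (W 2).
  apply: variety_and; first exact: generated_variety_is_variety.
  exact: satisfies_variety.
pose len j := j.*2.+3.
have synP j := syntactic_algebra (@clique_perm (len j)).
pose A j := proj1_sig (constructive_indefinite_description _ (synP j)).
have AP j : forall s t, valid (A j) s t <->
    forall sigma, same_fit (clique (len j)) (subst sigma s) (subst sigma t).
  by rewrite /A; case: constructive_indefinite_description.
apply: (not_hereditarily_finitely_based (e := odd_cycle_identity) (A :=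
  A)) => //.
- move=> j; apply: syntactic_algebra_W2 (AP j); first exact: clique_perm.
    exact: clique_prefix.
  by move=> u [].
- move=> m n lt_mn; apply/AP => sigma w.
  have no_fit : ~ fits (clique (len n)) w (subst sigma (cycle_term m.*2.+2)).
    by apply: odd_cycle_fits_no_clique; rewrite /len /= ?odd_double //; lia.
  by split=> [/no_fit // | /fits_add[/no_fit]].
- move=> j /AP /(_ Var [::]); rewrite !subst_Var => -[+ _].
  move/(_ (@cycle_term_fits_clique j.*2.+2 isT))/fits_add => [_ sq].
  by case: (sq [:: 0; 0]) => //; rewrite /words /= inE.
Qed.

(** * The identities of [W k] *)

Definition has_power (k : nat) (t : term) : Prop :=
  exists2 u, u \in words t & exists i, k <= count_mem i u.

(** The indicator valuation of a letter gives a term the largest exponent of that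
    letter in it, so valid identities preserve these exponents. *)
Lemma valid_has_power k s t : valid algN s t -> has_power k t -> has_power k s.
Proof.
move=> st [u tu [i le_k]].
have [w sw le_w] := words_dominate (fun j => j == i) st tu.
exists w => //; exists i; apply: leq_trans le_k _.
by rewrite -!weight_count.
Qed.

Lemma has_power_subst k sigma t : has_power k t -> has_power k (subst sigma t).
Proof.
case=> u tu [i le_k].
pose pick j := head [::] (words (sigma j)).
have pickP j : pick j \in words (sigma j).
  by rewrite /pick; case: (words _) (words_neq0 (sigma j)) => //= a s _;
    rewrite inE eqxx.
exists (flatten [seq pick j | j <- u]).
  by rewrite words_subst; exact: (flatten_mem_monos (tau := words \o sigma)).
exists (head 0 (pick i)); apply: leq_trans le_k _.
elim: u {tu} => //= j u IH; rewrite count_cat leq_add //.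
have [->|//] := eqVneq j i.
by case: (pick i) (words_nonnil (pickP i)) => //= a s _; rewrite eqxx.
Qed.

Lemma has_power_add k s t :
  has_power k s \/ has_power k t -> has_power k (Add s t).
Proof.
by case=> -[u tu u_k]; exists u;
  rewrite // /words mem_cat -!/(words _) tu ?orbT.
Qed.

Lemma has_power_mul k s t :
  has_power k s \/ has_power k t -> has_power k (Mul s t).
Proof.
have ex (r : term) : exists a, a \in words r.
  by case: (words r) (words_neq0 r) => // a ? _; exists a; rewrite inE eqxx.
case=> -[u tu [i u_k]].
  have [a ta] := ex t; exists (u ++ a); first exact: allpairs_f.
  by exists i; rewrite count_cat (leq_trans u_k) ?leq_addr.
have [a sa] := ex s; exists (a ++ u); first exact: allpairs_f.
by exists i; rewrite count_cat (leq_trans u_k) ?leq_addl.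
Qed.

Lemma has_power_pow k : 0 < k -> has_power k (term_pow (Var 0) k).
Proof.
case: k => // k _; exists (nseq k.+1 0); last by exists 0;
  rewrite count_nseq mul1n.
elim: k => // k IH.
have -> : nseq k.+2 0 = [:: 0] ++ nseq k.+1 0 by [].
by apply: (@allpairs_f _ _ _ _ [:: [:: 0]]).
Qed.

(** The conclusion, as a relation between [s] and [t], is a congruence of the
    term algebra, and the quotient belongs to [W k]. *)
Lemma W_valid k s t : 0 < k ->
  (forall A, W k A -> valid A s t) ->
  valid algN s t \/ has_power k s /\ has_power k t.
Proof.
move=> k_gt0 Wst.
pose R (s t : term_algebra) := valid algN s t \/ has_power k s /\ has_power k t.
have Rpow a b : R a b -> has_power k a -> has_power k b.
  by case=> [ab|[]//]; apply: valid_has_power => v; rewrite ab.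
have congR : congruence R.
  split=> [a|a b|a b c|a a' b b'|a a' b b'].
  - by left.
  - by case=> [ab|[]]; [left=> v; rewrite ab | right].
  - move=> [ab [bc|[b_k c_k]]|[a_k b_k] bc].
    + by left=> v; rewrite ab.
    + by right; split=> //; exact: valid_has_power b_k.
    + by right; split=> //; exact: Rpow bc b_k.
  - move=> [aa [bb|[bk bk']]|[ak ak'] _]; first by left=> v /=; rewrite aa bb.
      by right; split; apply: has_power_add; right.
    by right; split; apply: has_power_add; left.
  - move=> [aa [bb|[bk bk']]|[ak ak'] _]; first by left=> v /=; rewrite aa bb.
      by right; split; apply: has_power_mul; right.
    by right; split; apply: has_power_mul; left.
have [B [q qB]] := quotient_exists congR.
have /Wst /(quotient_validP _ _ qB) /(_ Var) : W k B.
  split.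
    apply: birkhoff => a b ab; apply/(quotient_validP _ _ qB) => sigma;
      left=> v.
    by rewrite !eval_subst ab.
  have pow_k : has_power k (term_pow (Var 0) k) by exact: has_power_pow.
  have sum_k : has_power k (Add (term_pow (Var 0) k) (Var 2)).
    by apply: has_power_add; left.
  apply/(quotient_validP _ _ qB) => sigma; right.
  exact: (conj (has_power_subst sigma sum_k) (has_power_subst sigma pow_k)).
by rewrite -!/(subst _ _) !subst_Var.
Qed.

(** * A cyclic simplex *)

Definition next (n i : nat) : nat := if i.+1 == n then 0 else i.+1.

(** The product of the variables below [n], with [next n i] traded for a second
    [i].  The exponent vectors of these [n] words are the vertices of a simplex
    whose barycenter is the exponent vector of the product. *)
Definition vertex (n i : nat) : seq nat := i :: rem (next n i) (iota 0 n).

Lemma next_lt n i : i < n -> next n i < n.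
Proof. by rewrite /next; case: eqP => [<-|]; lia. Qed.

Lemma next_neq n i : 1 < n -> next n i != i.
Proof. by rewrite /next; case: ifP => [/eqP|_]; lia. Qed.

Lemma perm_vertex n i :
  i < n -> perm_eq (next n i :: vertex n i) (i :: iota 0 n).
Proof.
move=> lt_in; rewrite (permPl (permEl (perm_catCA [:: next n i] [:: i] _))).
by rewrite perm_cons perm_sym perm_to_rem // mem_iota next_lt.
Qed.

Definition occ (j : nat) (u : seq nat) : nat := count_mem j u.

Lemma weight_occ j u : weight (fun i => i == j) u = occ j u.
Proof. exact: weight_count. Qed.

Lemma count_iota0 n j : count_mem j (iota 0 n) = (j < n).
Proof. by rewrite count_uniq_mem ?iota_uniq // mem_iota. Qed.

Lemma count_vertex n i j : i < n ->
  (next n i == j) + occ j (vertex n i) = (i == j) + (j < n).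
Proof. by move/perm_vertex/permP/(_ (pred1 j));
  rewrite /= count_iota0 /occ. Qed.

Definition under_vertex (n : nat) (u : seq nat) : Prop :=
  exists2 i, i < n & forall j, occ j u <= occ j (vertex n i).

Lemma under_vertex_perm n : perm_closed (under_vertex n).
Proof.
move=> u w /permP uw [i lt_in le_u]; exists i => // j.
by rewrite /occ -uw; exact: le_u.
Qed.

(** A word dominated by the facet of the simplex opposite to the vertex [i0]
    lies below a vertex.  It has at most one occurrence of each letter unless it
    is below the vertex with a double occurrence of that letter; the only
    square-free word below no vertex is the barycenter, which a valuation that
    increases along the cycle, starting after [i0], separates from the facet. *)
Lemma facet_under_vertex n i0 c : 1 < n -> i0 < n ->
  (forall v, exists i, [/\ i < n,
    i != i0 & weight v c <= weight v (vertex n i)]) ->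
  under_vertex n c.
Proof.
move=> n_gt1 lt_i0 dom.
have single j : occ j c <= (j < n).*2.
  have [i [lt_in _]] := dom (fun l => l == j); rewrite !weight_occ => le_c.
  have := count_vertex j lt_in; have [ij|_] := eqVneq i j; last by lia.
  by move: le_c; rewrite -ij lt_in; lia.
have [/hasP[j _ /= ge2]|/hasPn le1] := boolP (has (fun j => 1 < occ j c) c).
  have lt_jn : j < n by have := single j; lia.
  have next_j := next_neq j n_gt1.
  exists j => // l; have [->|ne_lj] := eqVneq l j.
    have := count_vertex j lt_jn; have := single j.
    by rewrite eqxx (negPf next_j) lt_jn; lia.
  (* A word below another vertex has weight at most 3 + 2 under this valuation,
     while c has weight at least 3 * 2: so the dominating vertex is that of j. *)
  have wE u : weight (fun a => 3 * (a == j) + (a == l)) u =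
              3 * occ j u + occ l u.
    by rewrite /weight big_split -big_distrr /= -!/(weight _ _) !weight_occ.
  have [i [lt_in _]] := dom (fun a => 3 * (a == j) + (a == l)).
  rewrite !wE; have := count_vertex j lt_in; have := count_vertex l lt_in.
  have [->|ne_ij] := eqVneq i j; last by lia.
  by rewrite (negPf next_j); lia.
have {}le1 j : occ j c <= (j < n).
  have := single j; case: (j < n) => //.
  by have [/le1|/count_memPn] := boolP (j \in c); rewrite -/(occ j c); lia.
have [/allP full|/allPn[j]] := boolP (all [in c] (iota 0 n)); last first.
  rewrite mem_iota /= => lt_jn /count_memPn; rewrite -/(occ j c) => c_j.
  (* the predecessor of j in the cycle: only j is missing from its vertex *)
  pose i := if j == 0 then n.-1 else j.-1.
  have lt_in : i < n by rewrite /i; case: eqP; lia.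
  have next_i : next n i = j by rewrite /i /next; do 2![case: eqP]; lia.
  exists i => // l; have := count_vertex l lt_in; rewrite next_i.
  by have := le1 l; case: eqP => [<-|_]; rewrite ?c_j //; lia.
have c_perm : perm_eq c (iota 0 n).
  have memE j : (j \in c) = (occ j c == 1).
    by rewrite -has_pred1 has_count -/(occ j c); have := le1 j; case: (j < n);
      lia.
  have c_uniq : uniq c.
    by apply: count_mem_uniq => j; rewrite memE -/(occ j c); have := le1 j;
      case: (j < n); lia.
  apply: uniq_perm; rewrite ?iota_uniq // => j; apply/idP/idP => [|/full//].
  by rewrite memE mem_iota /=; have := le1 j; case: (j < n); lia.
pose v j := if j <= i0 then j + n else j.
have [i [lt_in ne_i]] := dom v; rewrite (perm_weight _ c_perm).
have := perm_weight v (perm_vertex lt_in); rewrite !weight_cons.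
suff : v i < v (next n i) by lia.
have : i.+1 = n /\ next n i = 0 \/ next n i = i.+1.
  by rewrite /next; case: eqP; [left | right].
rewrite /v; case: (leqP i i0) => ?; case: (leqP (next n i) i0) => ?; lia.
Qed.

Fixpoint word_term (i : nat) (u : seq nat) : term :=
  if u is j :: u' then Mul (Var i) (word_term j u') else Var i.

Lemma words_word_term i u : words (word_term i u) = [:: i :: u].
Proof.
by elim: u i => //= j u IH i; rewrite /words /= -!/(words _) IH.
Qed.

Definition vertices_term (n : nat) : term :=
  let t i := word_term i (rem (next n i) (iota 0 n)) in
  sum_term (t 0) [seq t i | i <- iota 1 n.-1].

Definition barycenter_term (n : nat) : term := word_term 0 (iota 1 n.-1).

Lemma words_vertices_term n u : 0 < n ->
  reflect (exists2 i, i < n & u = vertex n i) (u \in words (vertices_term n)).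
Proof.
case: n => // n _; rewrite /vertices_term words_sum_term -map_comp mem_cat.
rewrite words_word_term inE -/(vertex n.+1 0).
have -> : flatten [seq (words \o fun i => word_term i (rem (next n.+1 i) (iota 0 n.+1))) i
                  | i <- iota 1 n] = [seq vertex n.+1 i | i <- iota 1 n].
  by elim: (iota 1 n) => // i s /= ->; rewrite words_word_term.
apply: (iffP orP) => [[/mapP[i]|/eqP->]|[[|i] lt_in ->]].
- by rewrite mem_iota => /andP[_ lt_in] ->; exists i.
- by exists 0.
- by right.
- by left; apply: map_f; rewrite mem_iota /=; lia.
Qed.

Lemma words_barycenter_term n : 0 < n ->
  words (barycenter_term n) = [:: iota 0 n].
Proof. by case: n => // n _; rewrite words_word_term. Qed.

(** A valuation that is largest at [i] does not decrease when [next n i] is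
    traded for [i]. *)
Lemma barycenter_valid n : 0 < n ->
  valid algN (vertices_term n) (Add (vertices_term n) (barycenter_term n)).
Proof.
move=> n_gt0; apply: words_valid => v u.
  by move=> u_v; exists u; rewrite // words_Add mem_cat u_v.
rewrite words_Add mem_cat words_barycenter_term // inE.
case/orP => [u_v|/eqP->]; first by exists u.
pose i := [arg max_(i > Ordinal n_gt0) v i].
have max_i j : j < n -> v j <= v i.
  move=> lt_jn; rewrite /i; case: arg_maxnP => // k _ k_max.
  exact: (k_max (Ordinal lt_jn) isT).
exists (vertex n i); first by apply/(words_vertices_term _ n_gt0); exists i.
have := perm_weight v (perm_vertex (ltn_ord i)); rewrite !weight_cons.
by have := max_i _ (next_lt (ltn_ord i)); lia.
Qed.

Lemma barycenter_not_under n : 1 < n -> ~ under_vertex n (iota 0 n).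
Proof.
move=> n_gt1 [i lt_in /(_ (next n i))].
have := count_vertex (next n i) lt_in; rewrite eqxx /occ count_iota0 next_lt //.
by rewrite eq_sym (negPf (next_neq i n_gt1)); lia.
Qed.

(** * Identities with few words *)

Lemma sub_monos tau rho t :
  (forall i, {subset tau i <= rho i}) -> {subset monos tau t <= monos rho t}.
Proof.
move=> sub; elim: t => //= s IHs t IHt u;
  first by rewrite !mem_cat => /orP[/IHs|/IHt] ->; rewrite ?orbT.
by case/allpairsP => -[a b] /= [/IHs sa /IHt tb ->]; exact: allpairs_f.
Qed.

Definition leaves (t : term) : nat :=
  eval (A := Algebra 0 addn addn) (fun=> 1) t.

Definition word_bound (L : nat) (t : term) : nat :=
  eval (A := Algebra 0 addn muln) (fun=> L) t.

Lemma size_monos tau L t :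
  (forall i, size (tau i) <= L) -> size (monos tau t) <= word_bound L t.
Proof.
move=> tauL; elim: t => //= s IHs t IHt.
  by rewrite size_cat leq_add.
by rewrite size_allpairs leq_mul.
Qed.

(** Producing one word of an instance of [t] takes at most one word of each
    variable's image for each occurrence of that variable in [t]. *)
Lemma select_words rho t u :
  (forall i, rho i != [::]) -> u \in monos rho t ->
  exists tau, [/\ forall i, tau i != [::], forall i, {subset tau i <= rho i},
    forall i, size (tau i) <= leaves t & u \in monos tau t].
Proof.
move=> rho0.
have pickP i : head [::] (rho i) \in rho i.
  by case: (rho i) (rho0 i) => //= a s _; rewrite inE eqxx.
have join tau1 tau2 : (forall i, tau1 i != [::]) ->
    (forall i, {subset tau1 i <= rho i}) -> (forall i,
      {subset tau2 i <= rho i}) ->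
    [/\ forall i, tau1 i ++ tau2 i != [::],
        forall i, {subset tau1 i ++ tau2 i <= rho i},
        forall i, {subset tau1 i <= tau1 i ++ tau2 i} &
        forall i, {subset tau2 i <= tau1 i ++ tau2 i}].
  move=> n1 s1 s2; split=> i; first by case: (tau1 i) (n1 i).
  - by move=> a; rewrite mem_cat => /orP[/s1|/s2].
  - by move=> a a1; rewrite mem_cat a1.
  - by move=> a a2; rewrite mem_cat a2 orbT.
elim: t u => [i|s IHs t IHt|s IHs t IHt] u /=.
- move=> u_i; exists (fun j => [:: if j == i then u else head [::] (rho j)]).
  split=> // [j a|]; last by rewrite eqxx inE.
  by rewrite inE => /eqP->; case: eqP => [->|].
- pose tau0 i := [:: head [::] (rho i)].
  have tau0s i : {subset tau0 i <= rho i} by move=> a; rewrite inE => /eqP->.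
  have pos r : 0 < leaves r.
    by elim: r => // r1 IH1 r2 IH2; rewrite /leaves /= addn_gt0 IH1.
  rewrite mem_cat => /orP[/IHs|/IHt] [tau [n1 s1 sz u_tau]]; exists tau;
    split=> // [i|]; rewrite ?mem_cat ?u_tau ?orbT //;
    by apply: leq_trans (sz i) _; rewrite /leaves /= (leq_addr, leq_addl).
- case/allpairsP => -[a b] /= [/IHs[tau1 [n1 s1 z1 a1]] /IHt[tau2 [n2 s2 z2 b2]] ->].
  have [n12 s12 s1' s2'] := join tau1 tau2 n1 s1 s2.
  exists (fun i => tau1 i ++ tau2 i); split=> // [i|];
    first by rewrite size_cat leq_add.
  by apply: allpairs_f; [apply: sub_monos a1 | apply: sub_monos b2].
Qed.

Lemma missed_index (T : eqType) (us : seq T) n (Q : nat -> T -> Prop) :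
  size us < n -> (forall u, u \in us -> exists2 i, i < n & Q i u) ->
  exists2 i0, i0 < n & forall u, u \in us -> exists i, [/\ i < n,
    i != i0 & Q i u].
Proof.
move=> lt_n usQ.
have [js [sz jsQ]] : exists js, size js = size us /\
    forall u, u \in us -> exists i, [/\ i < n, i \in js & Q i u].
  elim: us usQ {lt_n} => [|u us IH] usQ; first by exists [::].
  have [w wus|js [sz jsQ]] := IH; first by apply: usQ; rewrite inE wus orbT.
  have [|i lt_in Qi] := usQ u; first by rewrite inE eqxx.
  exists (i :: js); split=> [|w]; first by rewrite /= sz.
  rewrite inE => /orP[/eqP->|/jsQ[j [lt_jn j_js Qj]]].
    by exists i; rewrite inE eqxx.
  by exists j; rewrite inE j_js orbT.
have /allPn[i0] : ~~ all [in js] (iota 0 n).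
  apply: contraL lt_n => /allP sub;
    rewrite -leqNgt -sz -[n in n <= _](size_iota 0).
  by apply: uniq_leq_size; rewrite ?iota_uniq.
rewrite mem_iota /= => lt_i0 i0_js; exists i0 => // u /jsQ[i [lt_in i_js Qi]].
by exists i; split=> //; apply: contraNneq i0_js => <-.
Qed.

(** The words of an instance of [s] that an instance of one word of [t] needs
    are fewer than the vertices, so they miss one: all of them lie below the
    opposite facet, which therefore dominates the word of [t]. *)
Lemma few_words_fit n s t sigma w :
  1 < n -> word_bound (leaves t) s < n -> valid algN s t ->
  fits (under_vertex n) w (subst sigma s) ->
    fits (under_vertex n) w (subst sigma t).
Proof.
move=> n_gt1 small st fit u; rewrite words_subst.
case/select_words => [i|tau [tau0 sub sz tu]]; first exact: words_neq0.
have us_fit b : b \in monos tau s -> under_vertex n (w ++ b).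
  by move=> sb; apply: fit; rewrite words_subst; apply: sub_monos sb.
have lt_us : size (monos tau s) < n by apply: leq_ltn_trans small;
  exact: size_monos.
have [i0 lt_i0 facet] := missed_index lt_us us_fit.
apply: (facet_under_vertex n_gt1 lt_i0) => v.
have [b sb le_b] := valid_dominates v st tau0 tu.
have [i [lt_in ne_i le_v]] := facet b sb; exists i; split=> //.
apply: leq_trans (leq_weight v le_v).
by rewrite !weight_cat leq_add2l.
Qed.

(** A vertex contains no letter more than twice. *)
Lemma has_power_no_fit n t sigma w k :
  2 < k -> has_power k t -> ~ fits (under_vertex n) w (subst sigma t).
Proof.
move=> k_gt2 /(has_power_subst sigma) [u tu [j u_k]] /(_ u tu) [i lt_in /(_ j)].
rewrite /occ count_cat -/(occ j (vertex n i)).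
by have := count_vertex j lt_in; do 3![case: (_ == _) || case: (_ < _)]; lia.
Qed.

Lemma W_nonfinitely_based k : 2 < k -> ~ finitely_based (W k).
Proof.
move=> k_gt2 [Sigma SigmaP].
have k_gt0 : 0 < k by apply: ltn_trans k_gt2.
have [n [n_gt1 small]] : exists n, 1 < n /\ forall s t,
  List.In (Identity s t) Sigma ->
    word_bound (leaves t) s < n /\ word_bound (leaves s) t < n.
  elim: {SigmaP} Sigma => [|[a b] Sigma [n [n_gt1 small]]]; first by exists 2.
  exists (n + (word_bound (leaves b) a + word_bound (leaves a) b)).
  split=> [|s t [[<- <-]|/small[]]]; lia.
have [B BP] := syntactic_algebra (@under_vertex_perm n).
have WB : W k B.
  apply/SigmaP => -[s t] stS; apply/BP => sigma w.
  have [small_s small_t] := small s t stS.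
  have [A WA|st|[s_k t_k]] := @W_valid k s t k_gt0.
  - exact: ((SigmaP A).1 WA _ stS).
  - by split; apply: few_words_fit => // v; rewrite st.
  - by split=> /(has_power_no_fit k_gt2); case.
have n_gt0 : 0 < n by apply: ltnW.
have [VB _] := WB.
have /BP/(_ Var [::]) := generated_variety_valid VB (barycenter_valid n_gt0).
rewrite !subst_Var => -[fitb _].
have /fitb/fits_add[_] : fits (under_vertex n) [::] (vertices_term n).
  by move=> u /words_vertices_term -/(_ n_gt0)[i lt_in ->]; exists i.
move/(_ (iota 0 n)); rewrite words_barycenter_term // inE => /(_ (eqxx _)).
exact: barycenter_not_under.
Qed.

Theorem corollary9p3 :
  defined_by (W 2)
    (comm_ai_semiring_axioms ++ [:: x * y + x ≈ x * y; x ^ 2 + z ≈ x ^ 2])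
  /\ finitely_based (W 2)
  /\ ~ hereditarily_finitely_based (W 2)
  /\ (forall k : nat, 3 <= k -> ~ finitely_based (W k)).
Proof.
split; first exact: W2_defined_by.
split; first by exists W2_basis; exact: W2_defined_by.
split; first exact: W2_not_hereditarily_finitely_based.
exact: W_nonfinitely_based.
Qed.
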